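(* Let $h\in(0,1]$ and let $c_0,c_1,c_2,c_3\in\mathbb{C}$ satisfy $$\begin{array}{l}6c_1^3c_3-3c_1^2c_2^2-18c_1c_2c_3+8c_2^3+9c_3^2+h(3c_1^3c_2-6c_1c_2^2-9c_1^2c_3+18c_2c_3)\\ \qquad+h^2(3c_1c_3-5c_1^2c_2+8c_2^2)+2h^3c_1c_2=0.\end{array}$$ Then there exist $\lambda,\mu,\nu\in\mathbb{C}$ such that the infinitesimal deformation of the standard embedding with parameters $(c_0,c_1,c_2,c_3)$ is the infinitesimal part of the polynomial deformation $\widetilde\pi_{\lambda,\mu,\nu}$.
   Context: $\mathrm{Vect}(S^1)$ is the Lie algebra of smooth vector fields $f\partial$, $\partial=d/dx$, on the circle, with $[f\partial,g\partial]=(fg'-f'g)\partial$. For $h\in(0,1]$, $\Psi\mathrm{D}_h(S^1)$ is the space of formal series $F=\sum_{k\in\mathbb{Z}}f_k(x)\xi^k$ with $f_k\in C^\infty(S^1)$ complex-valued and $f_k=0$ for all sufficiently large $k$, with the associative product $$F\circ_hG=\sum_{k\ge0}\frac{h^k}{k!}\,\partial_\xi^kF\;\partial_x^kG$$ (products on the right being those of commuting variables). It is viewed as a Lie algebra with bracket $\frac1h(F\circ_hG-G\circ_hF)$, so that $f\partial\mapsto f\xi$ (the standard embedding) is a Lie algebra homomorphism. For $h=1$ this is the algebra $\Psi\mathrm{D}(S^1)$ of pseudodifferential symbols with the commutator. For $\mu\in\mathbb{C}$ let $\Psi_\mu$ be the automorphism given by formal conjugation by $\xi^{\mu/h}$,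 $\Psi_\mu(F)=\xi^{\mu/h}\circ_hF\circ_h\xi^{-\mu/h}$, that is $$\Psi_\mu(f\xi^k)=\sum_{n\ge0}\frac{\mu(\mu-h)\cdots(\mu-(n-1)h)}{n!}f^{(n)}\xi^{k-n}$$ (for $h=1$, conjugation by $\xi^\mu$). For $\lambda,\mu,\nu\in\mathbb{C}$ set $$\widetilde\pi_{\lambda,\mu,\nu}(f\partial)=\Psi_\mu\left(f\xi+\nu f+\lambda f'\right).$$ Infinitesimal deformations of the standard embedding are parameterized by $(c_0,c_1,c_2,c_3)\in\mathbb{C}^4$, the coefficients of four 1-cocycles whose leading terms are $f,\ f',\ f''\xi^{-1},\ f'''\xi^{-2}$ respectively. The infinitesimal part of a deformation of the form $f\partial\mapsto f\xi+\sum_{k\ge0}A_k(f)\xi^{-k}$, with $A_k$ constant-coefficient linear differential operators, is the infinitesimal deformation with parameters: $c_0=$ coefficient of $f$ in $A_0(f)$, $c_1=$ coefficient of $f'$ in $A_0(f)$, $c_2=$ coefficient of $f''$ in $A_1(f)$, $c_3=$ coefficient of $f'''$ in $A_2(f)$. *)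

(* Defs.v *)
From HB Require Import structures.
From mathcomp Require Import all_boot all_order all_algebra.
From mathcomp Require Import complex.
From mathcomp Require Import all_classical all_reals all_analysis.
Set Implicit Arguments.
Unset Strict Implicit.
Unset Printing Implicit Defensive.
Import Order.TTheory GRing.Theory Num.Theory.
Import numFieldNormedType.Exports.
Local Open Scope classical_set_scope.
Local Open Scope complex_scope.
Local Open Scope ring_scope.

(** Complex-valued functions on the circle R / 2 pi Z. *)

(* d/dx, taken on the real and imaginary parts: [R[i]] carries no normed
   R-module structure in the library. *)
Definition cderive (R : realType) (f : R -> R[i]) : R -> R[i] :=
  fun x => (derive1 (fun y => complex.Re (f y)) x)
           +i* (derive1 (fun y => complex.Im (f y)) x).

Definition cderiven (R : realType) (n : nat) (f : R -> R[i]) : R -> R[i] :=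
  iter n (@cderive R) f.

Definition smooth_circle (R : realType) (f : R -> R[i]) : Prop :=
  (forall x, f (x + 2 * pi) = f x) /\
  (forall (n : nat) (x : R),
     derivable (fun y : R => complex.Re (cderiven n f y)) x 1 /\
     derivable (fun y : R => complex.Im (cderiven n f y)) x 1).

(** Vect(S^1): the vector field f d/dx is represented by f. *)

Definition vect_bracket (R : realType) (f g : R -> R[i]) : R -> R[i] :=
  fun x => f x * cderive g x - cderive f x * g x.

(** Formal symbols: [F k] is the coefficient of xi^k. The sums [\sum_(_ \in _)]
    below are the finitely supported sums of fsbigop (0 on infinite support);
    at each point x they have finite support as soon as the arguments satisfy
    [is_symbol]. *)

Definition xi_series (R : realType) := int -> R -> R[i].

Definition is_symbol (R : realType) (F : xi_series R) : Prop :=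
  (forall k, smooth_circle (F k)) /\
  (exists N : int, forall k, N < k -> F k = fun=> 0).

Definition dxi (R : realType) (F : xi_series R) : xi_series R :=
  fun m x => (m + 1)%:~R * F (m + 1) x.

Definition dx (R : realType) (F : xi_series R) : xi_series R :=
  fun m => cderive (F m).

Definition comm_mul (R : realType) (F G : xi_series R) : xi_series R :=
  fun m x => \sum_(i \in [set: int]) F i x * G (m - i) x.

Definition circ (R : realType) (h : R) (F G : xi_series R) : xi_series R :=
  fun m x => \sum_(k \in [set: nat])
    (h%:C ^+ k / k`!%:R) * comm_mul (iter k (@dxi R) F) (iter k (@dx R) G) m x.

Definition symbol_bracket (R : realType) (h : R) (F G : xi_series R) : xi_series R :=
  fun m x => (h%:C)^-1 * (circ h F G m x - circ h G F m x).

(* Formal conjugation by xi^(mu / h): the term f xi^k is sent to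
   \sum_n mu (mu - h) ... (mu - (n - 1) h) / n! f^(n) xi^(k - n). *)
Definition Psi (R : realType) (h : R) (mu : R[i]) (F : xi_series R) : xi_series R :=
  fun m x => \sum_(n \in [set: nat])
    ((\prod_(j < n) (mu - j%:R * h%:C)) / n`!%:R) *
    cderiven n (F (m + n%:Z)) x.

Definition pitilde (R : realType) (h : R) (lambda mu nu : R[i])
    (f : R -> R[i]) : xi_series R :=
  Psi h mu (fun k x =>
    if k == 1 then f x
    else if k == 0 then nu * f x + lambda * cderive f x
    else 0).

(** Deformations of the standard embedding f d/dx |-> f xi. *)

Definition lie_hom (R : realType) (h : R)
    (phi : (R -> R[i]) -> xi_series R) : Prop :=
  [/\ forall f, smooth_circle f -> is_symbol (phi f),
      forall (a : R[i]) f g, smooth_circle f -> smooth_circle g ->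
        phi (fun x => a * f x + g x) = fun k x => a * phi f k x + phi g k x
    & forall f g, smooth_circle f -> smooth_circle g ->
        phi (vect_bracket f g) = symbol_bracket h (phi f) (phi g)].

(* The constant-coefficient operator \sum_j p_j (d/dx)^j. *)
Definition diffop (R : realType) (p : {poly R[i]}) (f : R -> R[i]) : R -> R[i] :=
  fun x => \sum_(j < size p) p`_j * cderiven j f x.

(* [phi f] is f xi + \sum_(k >= 0) A_k(f) xi^(-k). *)
Definition has_expansion (R : realType) (phi : (R -> R[i]) -> xi_series R)
    (A : nat -> {poly R[i]}) : Prop :=
  forall f, smooth_circle f ->
    [/\ forall m : int, 1 < m -> phi f m = fun=> 0,
        phi f 1 = f
      & forall k : nat, phi f (- k%:Z) = diffop (A k) f].

(* [phi] is a deformation of the standard embedding whose infinitesimal part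
   has parameters (c0, c1, c2, c3). A constant-coefficient operator on
   smooth functions on the circle determines its coefficients, so [A] is
   unique. *)
Definition infinitesimal_part (R : realType) (h : R)
    (phi : (R -> R[i]) -> xi_series R) (c0 c1 c2 c3 : R[i]) : Prop :=
  lie_hom h phi /\
  exists A : nat -> {poly R[i]},
    has_expansion phi A /\
    [/\ (A 0%N)`_0 = c0, (A 0%N)`_1 = c1, (A 1%N)`_2 = c2 & (A 2%N)`_3 = c3].

(* Main.v *)
Require Import Defs.
From HB Require Import structures.
From mathcomp Require Import all_boot all_order all_algebra.
From mathcomp Require Import complex.
From mathcomp Require Import all_classical all_reals all_analysis.
From mathcomp Require Import ring zify.
Set Implicit Arguments.
Unset Strict Implicit.
Unset Printing Implicit Defensive.
Import Order.TTheory GRing.Theory Num.Theory.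
Import numFieldNormedType.Exports.
Local Open Scope complex_scope.
Local Open Scope ring_scope.

(** Expanding [pitilde] gives [c0 = nu], [c1 = mu + lambda],
    [c2 = mu (mu - h) / 2 + lambda mu] and
    [c3 = mu (mu - h) (mu - 2 h) / 6 + lambda mu (mu - h) / 2]. Eliminating
    [lambda], the parameter [mu] has to be a common root of a quadratic and a
    cubic polynomial, and the polynomial relation in the statement is, up to a
    factor 4, their resultant: the product of the values of the cubic at the two
    roots of the quadratic.

    That [pitilde] is a Lie algebra homomorphism comes down to [Psi] being
    multiplicative on symbols of order at most 1. Comparing the coefficients of
    [f^(i) g^(j)], this is the Vandermonde convolution for the binomial
    polynomials with step [h], together with Pascal's rule. *)

(** * Binomial polynomials with step [h] *)

(* The binomial polynomial with step [h], that is [h ^ n * 'C(x / h, n)]. *)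
Definition hbinom (K : numFieldType) (h x : K) (n : nat) : K :=
  (\prod_(j < n) (x - j%:R * h)) / n`!%:R.

Lemma hbinom0 (K : numFieldType) (h x : K) : hbinom h x 0 = 1.
Proof. by rewrite /hbinom big_ord0 fact0 divr1. Qed.

Lemma hbinomS (K : numFieldType) (h x : K) n :
  n.+1%:R * hbinom h x n.+1 = (x - n%:R * h) * hbinom h x n.
Proof.
rewrite /hbinom big_ord_recr /= factS natrM.
by field; rewrite nat1r !pnatr_eq0 -lt0n fact_gt0.
Qed.

(** Pascal's rule. Taking the factor [x + h] out of the left side leaves the product in
    [hbinom h x n], and [x + h = (x - n h) + (n + 1) h]. *)
Lemma hbinom_step (K : numFieldType) (h x : K) n :
  hbinom h (x + h) n.+1 = hbinom h x n.+1 + h * hbinom h x n.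
Proof.
apply: (mulfI (_ : n.+1%:R != 0)); first by rewrite pnatr_eq0.
rewrite [RHS]mulrDr (hbinomS h x) /hbinom big_ord_recl /= factS natrM.
under eq_bigr => i _.
  rewrite (_ : x + h - _ = x - i%:R * h); last first.
    by rewrite -natr1; ring.
  over.
by rewrite -natr1; field; rewrite natr1 !pnatr_eq0 -lt0n fact_gt0.
Qed.

(** Induction on [n] after multiplying by [n + 1 = k + (n + 1 - k)]: [hbinomS] lowers the index of
    one factor or of the other, and the resulting coefficients [x - k h] and [y - (n - k) h] add up
    to [x + y - n h]. *)
Lemma hbinom_vandermonde (K : numFieldType) (h x y : K) n :
  \sum_(k < n.+1) hbinom h x k * hbinom h y (n - k)%N = hbinom h (x + y) n.
Proof.
elim: n => [|n IHn]; first by rewrite big_ord1 !hbinom0 mulr1.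
apply: (mulfI (_ : n.+1%:R != 0)); first by rewrite pnatr_eq0.
rewrite hbinomS -IHn !mulr_sumr.
transitivity (\sum_(k < n.+2) (k%:R * hbinom h x k) * hbinom h y (n.+1 - k)%N
  + \sum_(k < n.+2) hbinom h x k * ((n.+1 - k)%:R * hbinom h y (n.+1 - k)%N)).
  rewrite -big_split /=; apply: eq_bigr => k _.
  by rewrite (natrB _ (ltn_ord k : k <= n.+1)%N); ring.
(* The first sum vanishes at [k = 0] and the second at [k = n + 1]; shifting the first one gives
   both the same index range. *)
rewrite big_ord_recl !mul0r add0r [X in _ + X]big_ord_recr /= subnn mul0r mulr0 addr0.
rewrite -big_split /=; apply: eq_bigr => k _.
rewrite /bump leq0n add1n subSS hbinomS subSn; last by case: k.
rewrite hbinomS natrB; last by case: k.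
ring.
Qed.

(** Cut the [i + j] factors of [hbinom h x (i + j)] after the first [i]: the remaining ones start at
    [x - i h]. *)
Lemma hbinom_trinomial (K : numFieldType) (h x : K) i j :
  hbinom h x i * hbinom h (x - i%:R * h) j = 'C(i + j, i)%:R * hbinom h x (i + j).
Proof.
rewrite /hbinom big_split_ord /=.
under [X in _ = _ * (_ * X / _)]eq_bigr => k _.
  rewrite (_ : x - _ = (x - i%:R * h) - k%:R * h); last first.
    by rewrite natrD; ring.
  over.
rewrite -(bin_fact (leq_addr j i)) addKn !natrM.
by field; rewrite !pnatr_eq0 -!lt0n !fact_gt0 bin_gt0 leq_addr.
Qed.

(** * Differential calculus of complex-valued functions *)

Definition cderivable (R : realType) (f : R -> R[i]) (x : R) : Prop :=
  derivable (fun y : R => complex.Re (f y)) x 1 /\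
  derivable (fun y : R => complex.Im (f y)) x 1.

(** Convertible to the differentiability half of [smooth_circle]; periodicity is treated separately,
    when values are shown to be symbols. *)
Definition csmooth (R : realType) (f : R -> R[i]) : Prop :=
  forall n x, cderivable (cderiven n f) x.

Lemma cderivenS (R : realType) n (f : R -> R[i]) :
  cderiven n.+1 f = cderive (cderiven n f).
Proof. by []. Qed.

Lemma cderivenSr (R : realType) n (f : R -> R[i]) :
  cderiven n.+1 f = cderiven n (cderive f).
Proof. by rewrite /cderiven iterSr. Qed.

(** The product is split into real and imaginary parts, and the real product rule is applied to the
    four products that arise. *)
Lemma is_cderiveM (R : realType) (f g : R -> R[i]) x :
  cderivable f x -> cderivable g x ->
  cderivable (fun y => f y * g y) x /\
  cderive (fun y => f y * g y) x = cderive f x * g x + f x * cderive g x.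
Proof.
rewrite /cderivable /cderive.
set fr := fun y => complex.Re (f y); set fi := fun y => complex.Im (f y).
set gr := fun y => complex.Re (g y); set gi := fun y => complex.Im (g y).
have -> : (fun y => complex.Re (f y * g y)) = fr * gr - fi * gi.
  by apply/funext => y; rewrite /fr /gr /fi /gi !fctE; case: (f y) (g y) => [? ?] [? ?].
have -> : (fun y => complex.Im (f y * g y)) = fr * gi + fi * gr.
  by apply/funext => y; rewrite /fr /gr /fi /gi !fctE; case: (f y) (g y) => [? ?] [? ?].
have -> : f x = fr x +i* fi x by rewrite /fr /fi; case: (f x).
have -> : g x = gr x +i* gi x by rewrite /gr /gi; case: (g x).
clearbody fr fi gr gi => -[dfr dfi] [dgr dgi].
have drr : derivable (fr * gr) x 1 := derivableM dfr dgr.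
have dii : derivable (fi * gi) x 1 := derivableM dfi dgi.
have dri : derivable (fr * gi) x 1 := derivableM dfr dgi.
have dir : derivable (fi * gr) x 1 := derivableM dfi dgr.
split; first by split; [exact: derivableB | exact: derivableD].
rewrite !derive1E (deriveB drr dii) (deriveD dri dir).
rewrite (deriveM dfr dgr) (deriveM dfi dgi) (deriveM dfr dgi) (deriveM dfi dgr).
move: (fr x) (fi x) (gr x) (gi x) ('D_1 fr x) ('D_1 fi x) ('D_1 gr x) ('D_1 gi x).
move=> a b c d a' b' c' d'; rewrite /GRing.scale /=; apply/eqP.
by rewrite eq_complex /=; apply/andP; split; apply/eqP; ring.
Qed.

Lemma is_cderiveD (R : realType) (f g : R -> R[i]) x :
  cderivable f x -> cderivable g x ->
  cderivable (fun y => f y + g y) x /\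
  cderive (fun y => f y + g y) x = cderive f x + cderive g x.
Proof.
rewrite /cderivable /cderive.
set fr := fun y => complex.Re (f y); set fi := fun y => complex.Im (f y).
set gr := fun y => complex.Re (g y); set gi := fun y => complex.Im (g y).
have -> : (fun y => complex.Re (f y + g y)) = fr + gr.
  by apply/funext => y; rewrite /fr /gr !fctE; case: (f y) (g y) => [? ?] [? ?].
have -> : (fun y => complex.Im (f y + g y)) = fi + gi.
  by apply/funext => y; rewrite /fi /gi !fctE; case: (f y) (g y) => [? ?] [? ?].
clearbody fr fi gr gi => -[dfr dfi] [dgr dgi].
split; first by split; exact: derivableD.
rewrite !derive1E (deriveD dfr dgr) (deriveD dfi dgi).
by move: ('D_1 fr x) ('D_1 gr x) ('D_1 fi x) ('D_1 gi x).
Qed.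

Lemma is_cderive_cst (R : realType) (c : R[i]) (x : R) :
  cderivable (fun=> c) x /\ cderive (fun=> c) x = 0.
Proof.
split; first by split; exact: derivable_cst.
by rewrite /cderive !derive1_cst.
Qed.

Lemma is_cderiveZ (R : realType) (c : R[i]) (f : R -> R[i]) x :
  cderivable f x ->
  cderivable (fun y => c * f y) x /\
  cderive (fun y => c * f y) x = c * cderive f x.
Proof.
move=> df; have [dc c0] := is_cderive_cst c x.
have [d ->] := is_cderiveM dc df.
by rewrite c0 mul0r add0r.
Qed.

Lemma is_cderive_sum (R : realType) n (F : 'I_n -> R -> R[i]) x :
  (forall i, cderivable (F i) x) ->
  cderivable (fun y => \sum_(i < n) F i y) x /\
  cderive (fun y => \sum_(i < n) F i y) x = \sum_(i < n) cderive (F i) x.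
Proof.
elim: n F => [|n IHn] F dF.
  under eq_fun do rewrite big_ord0.
  by rewrite big_ord0; exact: is_cderive_cst.
under eq_fun do rewrite big_ord_recr.
rewrite big_ord_recr /=.
have [d <-] := IHn (fun i => F (widen_ord (leqnSn n) i)) (fun i => dF _).
exact: (is_cderiveD d (dF ord_max)).
Qed.

Lemma cderive_affine (R : realType) (a b : R[i]) (f : R -> R[i]) x :
  csmooth f ->
  cderive (fun y => a * cderive f y + b * f y) x =
    a * cderive (cderive f) x + b * cderive f x.
Proof.
move=> sf; have [d1 E1] := is_cderiveZ a (sf 1 x).
have [d0 E0] := is_cderiveZ b (sf 0 x).
exact: etrans (is_cderiveD d1 d0).2 (f_equal2 +%R E1 E0).
Qed.

Lemma csmooth_cderive (R : realType) (f : R -> R[i]) :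
  csmooth f -> csmooth (cderive f).
Proof. by move=> sf n; rewrite -cderivenSr; exact: sf. Qed.

Lemma csmooth_cderiven (R : realType) n (f : R -> R[i]) :
  csmooth f -> csmooth (cderiven n f).
Proof.
by move=> sf; elim: n => [|n IHn]; [exact: sf | exact: (csmooth_cderive IHn)].
Qed.

Lemma cderiven_lin (R : realType) (c : R[i]) n (f g : R -> R[i]) :
  csmooth f -> csmooth g ->
  cderiven n (fun x => c * f x + g x) =
    fun x => c * cderiven n f x + cderiven n g x.
Proof.
move=> sf sg; elim: n => // n IHn.
rewrite cderivenS IHn; apply/funext => x.
have [dc cE] := is_cderiveZ c (sf n x).
by have [_ ->] := is_cderiveD dc (sg n x); rewrite cE.
Qed.

Lemma csmooth_lin (R : realType) (c : R[i]) (f g : R -> R[i]) :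
  csmooth f -> csmooth g -> csmooth (fun x => c * f x + g x).
Proof.
move=> sf sg n x; rewrite cderiven_lin //.
have [dc _] := is_cderiveZ c (sf n x).
by have [] := is_cderiveD dc (sg n x).
Qed.

Lemma cderiven_cst0 (R : realType) n : cderiven n (fun=> 0 : R[i]) = fun _ : R => 0.
Proof.
elim: n => // n IHn; rewrite cderivenS IHn; apply/funext => x.
by have [] := is_cderive_cst (0 : R[i]) x.
Qed.

Lemma csmooth0 (R : realType) : csmooth (fun _ : R => 0).
Proof. by move=> n x; rewrite cderiven_cst0; have [] := is_cderive_cst (0 : R[i]) x. Qed.

Lemma cderivenZ (R : realType) (c : R[i]) n (f : R -> R[i]) :
  csmooth f -> cderiven n (fun x => c * f x) = fun x => c * cderiven n f x.
Proof.
move=> sf; rewrite (_ : (fun x => _) = fun x => c * f x + 0); last first.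
  by apply/funext => x; rewrite addr0.
rewrite (cderiven_lin c n sf (@csmooth0 R)).
by rewrite cderiven_cst0; apply/funext => x; rewrite addr0.
Qed.

Lemma csmoothZ (R : realType) (c : R[i]) (f : R -> R[i]) :
  csmooth f -> csmooth (fun x => c * f x).
Proof.
by move=> sf n x; rewrite cderivenZ //; have [] := is_cderiveZ c (sf n x).
Qed.

Lemma cderivenD (R : realType) n (f g : R -> R[i]) :
  csmooth f -> csmooth g ->
  cderiven n (fun x => f x + g x) = fun x => cderiven n f x + cderiven n g x.
Proof.
move=> sf sg; rewrite (_ : (fun x => _) = fun x => 1 * f x + g x).
  by rewrite cderiven_lin //; apply/funext => x; rewrite mul1r.
by apply/funext => x; rewrite mul1r.
Qed.

(** Term-by-term differentiation of the Leibniz sum. It serves both the induction step of [leibniz]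
    and the differentiability in [csmoothM]. *)
Lemma leibniz_cderivable (R : realType) n (f g : R -> R[i]) x :
  csmooth f -> csmooth g ->
  let S := fun y => \sum_(i < n.+1)
    'C(n, i)%:R * (cderiven i f y * cderiven (n - i) g y) in
  cderivable S x /\
  cderive S x = \sum_(i < n.+1) 'C(n, i)%:R *
    (cderiven i.+1 f x * cderiven (n - i) g x +
     cderiven i f x * cderiven (n - i).+1 g x).
Proof.
move=> sf sg /=.
have dM (i : 'I_n.+1) := is_cderiveM (sf i x) (sg (n - i)%N x).
have dZ (i : 'I_n.+1) := is_cderiveZ ('C(n, i)%:R) (dM i).1.
have [dS ->] := is_cderive_sum (fun i => (dZ i).1).
split=> //; apply: eq_bigr => i _.
by rewrite (dZ i).2 (dM i).2.
Qed.

Lemma leibniz (R : realType) n (f g : R -> R[i]) :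
  csmooth f -> csmooth g ->
  cderiven n (fun x => f x * g x) = fun x => \sum_(i < n.+1)
    'C(n, i)%:R * (cderiven i f x * cderiven (n - i) g x).
Proof.
move=> sf sg; elim: n => [|n IHn].
  by apply/funext => x; rewrite big_ord1 bin0 mul1r.
rewrite cderivenS IHn; apply/funext => x.
rewrite (leibniz_cderivable n x sf sg).2.
under eq_bigr do rewrite mulrDr.
rewrite big_split /= addrC [RHS]big_ord_recl bin0.
(* Pascal's rule splits the terms of positive index in the target; together with the term of index 0
   they form the two sums on the left. *)
under [X in _ = _ + X]eq_bigr => i _.
  rewrite lift0 binS natrD mulrDl subSS.
  over.
rewrite big_split /= addrA; congr (_ + _).
rewrite [LHS]big_ord_recl bin0 subn0; congr (_ + _).
(* The extra last term carries ['C(n, n.+1) = 0]. *)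
rewrite [RHS]big_ord_recr /= bin_small // mul0r addr0.
by apply: eq_bigr => i _; rewrite -(subnSK (ltn_ord i)).
Qed.

Lemma csmoothM (R : realType) (f g : R -> R[i]) :
  csmooth f -> csmooth g -> csmooth (fun x => f x * g x).
Proof.
by move=> sf sg n x; rewrite leibniz //; exact: (leibniz_cderivable n x sf sg).1.
Qed.

(** * Finitely supported sums and triangular reindexing *)

Lemma fsum_nat (V : nmodType) n (F : nat -> V) :
  (forall k, (n <= k)%N -> F k = 0) ->
  \sum_(k \in [set: nat]%classic) F k = \sum_(k < n) F k.
Proof.
move=> F0; rewrite fsbig_ord; apply/esym/fsbig_widen => // k [_ /= /negP].
by rewrite -leqNgt => /F0.
Qed.

(** The indices run downwards from [a] because the coefficients of a symbol vanish in high
    degree. *)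
Lemma fsum_int (V : nmodType) (a : int) n (F : int -> V) :
  (forall j, (forall i, (i < n)%N -> j <> a - i%:Z) -> F j = 0) ->
  \sum_(j \in [set: int]%classic) F j = \sum_(i < n) F (a - i%:Z).
Proof.
move=> F0; rewrite (fsbig_ord _ n (fun i => F (a - i%:Z))).
rewrite -(fsbig_image _ (fun i : nat => a - i%:Z) F); last first.
  by move=> i j _ _ /=; lia.
apply/esym/fsbig_widen => // j [_ /= nj]; apply: F0 => i lt_in ji.
by apply: nj; exists i.
Qed.

(** Both sides run over the pairs with [k + i <= l]. *)
Lemma exchange_triangle (V : nmodType) l (E : nat -> nat -> V) :
  \sum_(k < l.+1) \sum_(i < l.+1 - k) E k i =
  \sum_(i < l.+1) \sum_(k < l.+1 - i) E k i.
Proof.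
transitivity (\sum_(k < l.+1) \sum_(i < l.+1 | (i < l.+1 - k)%N) E k i).
  by apply: eq_bigr => k _; rewrite (big_ord_widen _ (E k) (leq_subr k l.+1)).
rewrite (exchange_big_dep predT) //=; apply: eq_bigr => i _.
rewrite (big_ord_widen _ (fun k => E k i) (leq_subr i l.+1)).
by apply: eq_bigl => k; rewrite !ltn_subRL addnC.
Qed.

(** Separates the degrees above an order bound [a], where coefficients vanish, from those at depth
    [l] below it, where they are finite sums governed by [l]. *)
Lemma int_gt_or_sub (a m : int) : a < m \/ exists l : nat, m = a - l%:Z.
Proof.
have [|le_ma] := ltP a m; first by left.
by right; exists `|a - m|%N; lia.
Qed.

(** * Order bounds and the coefficients of [Psi] *)

Definition order_le (R : realType) (a : int) (F : xi_series R) : Prop :=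
  forall m, a < m -> F m = fun=> 0.

Lemma Psi_order_le (R : realType) (h : R) mu a F :
  order_le a F -> order_le a (Psi h mu F).
Proof.
move=> F0 m lt_am; apply/funext => x; rewrite /Psi fsbig1 // => n _.
by rewrite F0 ?cderiven_cst0 ?mulr0 //; lia.
Qed.

(** Terms with [n > l] involve coefficients of [F] in degree above [a]. *)
Lemma PsiE (R : realType) (h : R) mu a F l x : order_le a F ->
  Psi h mu F (a - l%:Z) x = \sum_(n < l.+1)
    hbinom h%:C mu n * cderiven n (F (a - (l - n)%N%:Z)) x.
Proof.
move=> F0; rewrite /Psi (fsum_nat (n := l.+1)) => [|k lt_lk].
  apply: eq_bigr => n _; congr (_ * cderiven n (F _) x).
  by have := ltn_ord n; lia.
by rewrite F0 ?cderiven_cst0 ?mulr0 //; lia.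
Qed.

Lemma PsiD (R : realType) (h : R) mu a (F G : xi_series R) :
  order_le a F -> order_le a G ->
  (forall m, csmooth (F m)) -> (forall m, csmooth (G m)) ->
  Psi h mu (fun m x => F m x + G m x) =
    fun m x => Psi h mu F m x + Psi h mu G m x.
Proof.
move=> F0 G0 sF sG; set S := fun m x => _.
have S0 : order_le a S.
  by move=> m am; apply/funext => x; rewrite /S F0 // G0 // addr0.
apply/funext => m; apply/funext => x.
have [am|[l ->]] := int_gt_or_sub a m.
  by rewrite !(Psi_order_le _ _ _ am) // addr0.
rewrite !(PsiE _ _ _ (a := a)) // -big_split /=; apply: eq_bigr => n _.
rewrite -mulrDr; congr (_ * _).
by rewrite /S cderivenD.
Qed.

Definition monomial (R : realType) (a : int) (f : R -> R[i]) : xi_series R :=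
  fun m => if m == a then f else fun=> 0.

Lemma monomial_order_le (R : realType) a (f : R -> R[i]) :
  order_le a (monomial a f).
Proof. by move=> m am; rewrite /monomial gt_eqF. Qed.

Lemma csmooth_monomial (R : realType) a (f : R -> R[i]) m :
  csmooth f -> csmooth (monomial a f m).
Proof.
by rewrite /monomial => sf; case: eqP => _; [exact: sf | exact: csmooth0].
Qed.

Definition Psi_monomial (R : realType) (h : R) mu a f : xi_series R :=
  Psi h mu (monomial a f).

Lemma Psi_monomial_order_le (R : realType) (h : R) mu a f :
  order_le a (Psi_monomial h mu a f).
Proof. exact/Psi_order_le/monomial_order_le. Qed.

(** Only the term [n = l] reaches the single nonzero coefficient, in degree [a]. *)
Lemma Psi_monomialE (R : realType) (h : R) mu a f l :
  Psi_monomial h mu a f (a - l%:Z) =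
    fun x => hbinom h%:C mu l * cderiven l f x.
Proof.
apply/funext => x; rewrite /Psi_monomial (PsiE _ _ _ _ (monomial_order_le _)).
rewrite big_ord_recr /= subnn subr0 /monomial eqxx big1 ?add0r // => n _.
by rewrite lt_eqF ?cderiven_cst0 ?mulr0 //; have := ltn_ord n; lia.
Qed.

Lemma Psi_monomial_lin (R : realType) (h : R) mu a c (f g : R -> R[i]) m x :
  csmooth f -> csmooth g ->
  Psi_monomial h mu a (fun x => c * f x + g x) m x =
    c * Psi_monomial h mu a f m x + Psi_monomial h mu a g m x.
Proof.
move=> sf sg; have [am|[l ->]] := int_gt_or_sub a m.
  by rewrite !(Psi_monomial_order_le _ _ _ am) mulr0 addr0.
by rewrite !Psi_monomialE cderiven_lin // mulrDr mulrCA.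
Qed.

Lemma csmooth_Psi_monomial (R : realType) (h : R) mu a f m :
  csmooth f -> csmooth (Psi_monomial h mu a f m).
Proof.
move=> sf; have [am|[l ->]] := int_gt_or_sub a m.
  by rewrite (Psi_monomial_order_le _ _ _ am); exact: csmooth0.
by rewrite Psi_monomialE; apply: csmoothZ; exact: csmooth_cderiven.
Qed.

(** * Coefficients of the product [circ] *)

Lemma iter_dx (R : realType) k (G : xi_series R) m :
  iter k (@dx R) G m = cderiven k (G m).
Proof. by elim: k m => // k IHk m; rewrite iterS /dx IHk. Qed.

Lemma iter_dxi (R : realType) k (F : xi_series R) m x :
  iter k (@dxi R) F m x =
    (\prod_(j < k) ((m + k%:Z)%:~R - j%:R)) * F (m + k%:Z) x.
Proof.
elim: k m => [|k IHk] m; first by rewrite big_ord0 mul1r addr0.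
rewrite iterS {1}/dxi IHk mulrA [in RHS]big_ord_recr /= mulrC.
rewrite (_ : m + 1 + k%:Z = m + k.+1%:Z); last by lia.
rewrite [(m + 1)%:~R * _]mulrC mulrC; congr (_ * _ * _).
rewrite (_ : m + k.+1%:Z = m + 1 + k%:Z); last by lia.
by rewrite [in RHS]intrD addrK.
Qed.

(** Absorbing [h ^+ k] into the falling factorial puts the coefficients of [circ] in the same
    polynomial family as those of [Psi], so that the Vandermonde convolution can combine them. *)
Lemma hbinom_scale (K : numFieldType) (h x : K) k :
  h ^+ k / k`!%:R * \prod_(j < k) (x - j%:R) = hbinom h (h * x) k.
Proof.
rewrite /hbinom mulrAC; congr (_ / _).
rewrite -[k in h ^+ k]card_ord -prodr_const -big_split /=.
by apply: eq_bigr => j _; ring.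
Qed.

Lemma circ_order_le (R : realType) (h : R) a b F G :
  order_le a F -> order_le b G -> order_le (a + b) (circ h F G).
Proof.
move=> F0 G0 m lt_abm; apply/funext => x; rewrite /circ fsbig1 // => k _.
rewrite /comm_mul fsbig1 ?mulr0 // => i _; rewrite iter_dxi iter_dx.
have [lt_ai|le_ia] := ltP a (i + k%:Z); first by rewrite F0 // mulr0 mul0r.
by rewrite G0 ?cderiven_cst0 ?mulr0 //; lia.
Qed.

(** The depth [l] is shared out: [k] for the derivatives, [i] for the coefficient of [F], and
    [l - k - i] for that of [G]. *)
Lemma circE (R : realType) (h : R) a b F G l x :
  order_le a F -> order_le b G ->
  circ h F G (a + b - l%:Z) x = \sum_(k < l.+1) \sum_(i < l.+1 - k)
    hbinom h%:C (h%:C * (a - i%:Z)%:~R) k * F (a - i%:Z) x *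
    cderiven k (G (b - (l - k - i)%N%:Z)) x.
Proof.
move=> F0 G0; rewrite /circ.
have termE k : h%:C ^+ k / k`!%:R *
    comm_mul (iter k (@dxi R) F) (iter k (@dx R) G) (a + b - l%:Z) x =
    \sum_(i < l.+1 - k)
      hbinom h%:C (h%:C * (a - i%:Z)%:~R) k * F (a - i%:Z) x *
      cderiven k (G (b - (l - k - i)%N%:Z)) x.
  rewrite /comm_mul (fsum_int (a := a - k%:Z) (n := l.+1 - k)); last first.
    move=> j nj; rewrite iter_dxi iter_dx.
    have [lt_aj|le_ja] := ltP a (j + k%:Z); first by rewrite F0 // mulr0 mul0r.
    have [lt_bj|le_jb] := ltP b (a + b - l%:Z - j).
      by rewrite G0 // cderiven_cst0 mulr0.
    (* Both factors within their order bounds force [a - l <= j <= a - k], which is the range of the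
       sum. *)
    by case: (nj (absz (a - k%:Z - j)%R)); lia.
  rewrite mulr_sumr; apply: eq_bigr => i _; rewrite iter_dxi iter_dx.
  rewrite -hbinom_scale !mulrA.
  rewrite (_ : a - k%:Z - i%:Z + k%:Z = a - i%:Z); last by lia.
  rewrite (_ : a + b - l%:Z - (a - k%:Z - i%:Z) = b - (l - k - i)%N%:Z) //.
  by have := ltn_ord i; lia.
rewrite (fsum_nat (n := l.+1)) => [|k lt_lk].
  by apply: eq_bigr => k _; exact: termE.
(* For [k > l] the truncated difference [l.+1 - k] is 0 and the inner sum is empty. *)
rewrite termE big1 // => i _; case: i => i /= lt_i.
by exfalso; lia.
Qed.

Lemma circDl (R : realType) (h : R) a b (F F' G : xi_series R) m x :
  order_le a F -> order_le a F' -> order_le b G ->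
  circ h (fun m x => F m x + F' m x) G m x = circ h F G m x + circ h F' G m x.
Proof.
move=> F0 F'0 G0; set S := fun m x => _.
have S0 : order_le a S.
  by move=> n an; apply/funext => y; rewrite /S F0 // F'0 // addr0.
have [am|[l ->]] := int_gt_or_sub (a + b) m.
  by rewrite !(circ_order_le _ _ _ am) // addr0.
rewrite !(circE h (a := a) (b := b)) // -big_split /=; apply: eq_bigr => k _.
by rewrite -big_split /=; apply: eq_bigr => i _; rewrite mulrDr mulrDl.
Qed.

Lemma circDr (R : realType) (h : R) a b (F G G' : xi_series R) m x :
  order_le a F -> order_le b G -> order_le b G' ->
  (forall m, csmooth (G m)) -> (forall m, csmooth (G' m)) ->
  circ h F (fun m x => G m x + G' m x) m x = circ h F G m x + circ h F G' m x.
Proof.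
move=> F0 G0 G'0 sG sG'; set S := fun m x => _.
have S0 : order_le b S.
  by move=> n bn; apply/funext => y; rewrite /S G0 // G'0 // addr0.
have [am|[l ->]] := int_gt_or_sub (a + b) m.
  by rewrite !(circ_order_le _ _ _ am) // addr0.
rewrite !(circE h (a := a) (b := b)) // -big_split /=; apply: eq_bigr => k _.
rewrite -big_split /=; apply: eq_bigr => i _; rewrite -mulrDr; congr (_ * _).
by rewrite /S cderivenD.
Qed.

(** * Multiplicativity of [Psi] in order at most 1 *)

Lemma circ_Psi_monomialE (R : realType) (h : R) mu a b f g l x :
  csmooth f -> csmooth g ->
  circ h (Psi_monomial h mu a f) (Psi_monomial h mu b g) (a + b - l%:Z) x =
  \sum_(i < l.+1) hbinom h%:C mu i *
    hbinom h%:C (mu - i%:R * h%:C + a%:~R * h%:C) (l - i)%N *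
    (cderiven i f x * cderiven (l - i) g x).
Proof.
move=> sf sg; rewrite (circE h _ _ (a := a) (b := b));
  [|exact: Psi_monomial_order_le..].
(* With [i] outermost, the inner sum collects everything that multiplies [f^(i) g^(l - i)]. *)
rewrite (exchange_triangle l (fun k i =>
  hbinom h%:C (h%:C * (a - i%:Z)%:~R) k * Psi_monomial h mu a f (a - i%:Z) x *
    cderiven k (Psi_monomial h mu b g (b - (l - k - i)%N%:Z)) x)).
apply: eq_bigr => i _; rewrite subSn -1?ltnS //.
rewrite (_ : mu - i%:R * h%:C + a%:~R * h%:C = h%:C * (a - i%:Z)%:~R + mu); last first.
  by rewrite intrB; ring.
(* Vandermonde in [k]: one factor comes from [circ], the other from [Psi] acting on [g]. *)
rewrite -hbinom_vandermonde mulr_sumr mulr_suml; apply: eq_bigr => k _.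
rewrite !Psi_monomialE cderivenZ; last exact: csmooth_cderiven.
(* The [k] derivatives from [circ] and the [l - i - k] from [Psi] make [l - i] in all. *)
rewrite -[cderiven k _](_ : cderiven (l - i) g = _); last first.
  rewrite /cderiven -iterD; congr (iter _ _ _).
  by have := ltn_ord k; have := ltn_ord i; lia.
rewrite subnAC.
move: (hbinom _ _ (_ - k)) (hbinom _ _ k) (hbinom _ _ i).
by move: (cderiven i f x) (cderiven _ g x) => *; ring.
Qed.

(** For [a = 0] the trinomial identity makes the coefficient of [f^(i) g^(l - i)] equal to
    ['C(l, i)] times [hbinom h mu l], which is the Leibniz expansion. *)
Lemma circ_Psi_monomial0 (R : realType) (h : R) mu b f g m x :
  csmooth f -> csmooth g ->
  circ h (Psi_monomial h mu 0 f) (Psi_monomial h mu b g) m x =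
    Psi_monomial h mu b (fun y => f y * g y) m x.
Proof.
move=> sf sg; have [bm|[l ->]] := int_gt_or_sub b m.
  rewrite (circ_order_le _ (Psi_monomial_order_le _ _ _) (Psi_monomial_order_le _ _ _));
    last by rewrite add0r.
  by rewrite (Psi_monomial_order_le _ _ _ bm).
have := circ_Psi_monomialE h mu 0 b l x sf sg; rewrite add0r => ->.
rewrite Psi_monomialE leibniz //.
rewrite mulr_sumr; apply: eq_bigr => i _.
rewrite mul0r addr0 hbinom_trinomial subnKC -1?ltnS //.
ring.
Qed.

(** The image under [Psi] of [f xi] times [g xi^b] being [f g xi^(1 + b) + h f g' xi^b]. Pascal's
    rule removes the shift by [h] due to [a = 1], and each of its two terms is a Leibniz
    expansion. *)
Lemma circ_Psi_monomial1 (R : realType) (h : R) mu b f g m x :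
  csmooth f -> csmooth g ->
  circ h (Psi_monomial h mu 1 f) (Psi_monomial h mu b g) m x =
    Psi_monomial h mu (1 + b) (fun y => f y * g y) m x +
    h%:C * Psi_monomial h mu b (fun y => f y * cderive g y) m x.
Proof.
move=> sf sg; have [bm|[l ->]] := int_gt_or_sub (1 + b) m.
  rewrite (circ_order_le _ (Psi_monomial_order_le _ _ _)
    (Psi_monomial_order_le _ _ _)) //.
  by rewrite !(Psi_monomial_order_le _ _ _ (_ : _ < m)) ?mulr0 ?addr0 //; lia.
rewrite circ_Psi_monomialE // Psi_monomialE leibniz //.
(* In the top degree [1 + b] the second summand vanishes. *)
case: l => [|l].
  rewrite (Psi_monomial_order_le _ _ _ (_ : b < _)); last by lia.
  by rewrite !big_ord1 !hbinom0 bin0; ring.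
rewrite (_ : 1 + b - l.+1%:Z = b - l%:Z) ?Psi_monomialE; last by lia.
rewrite (leibniz l sf (csmooth_cderive sg)).
(* The term [i = l + 1] is set apart: there the second index is 0, and Pascal's rule does not
   apply. *)
rewrite big_ord_recr [X in _ = _ * X + _]big_ord_recr /= !mulrDr !mulr_sumr.
rewrite subnn !hbinom0 binn [RHS]addrAC -big_split /=; congr (_ + _); last by ring.
apply: eq_bigr => i _; have le_il : (i <= l)%N by rewrite -ltnS.
rewrite subSn // mul1r hbinom_step mulrDr [hbinom _ _ _ * (h%:C * _)]mulrCA.
rewrite -subSn // !hbinom_trinomial.
rewrite !subnKC ?(leqW le_il) // subSn // cderivenSr; ring.
Qed.

(** * The Lie algebra homomorphism property of [pitilde] *)

Lemma pitildeE (R : realType) (h : R) lambda mu nu f : csmooth f ->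
  pitilde h lambda mu nu f = fun m x => Psi_monomial h mu 1 f m x +
    Psi_monomial h mu 0 (fun y => lambda * cderive f y + nu * f y) m x.
Proof.
move=> sf; rewrite /Psi_monomial -(PsiD h mu (a := 1)).
- congr (Psi h mu); apply/funext => k; apply/funext => x; rewrite /monomial.
  have [->|] := eqVneq k 1; first by rewrite addr0.
  by case: (eqVneq k 0) => _; rewrite add0r // addrC.
- exact: monomial_order_le.
- by move=> m lt1m; apply: monomial_order_le; lia.
- by move=> m; exact: csmooth_monomial.
- move=> m; apply: csmooth_monomial; apply: csmooth_lin; first exact: csmooth_cderive.
  exact: csmoothZ.
Qed.

Lemma cderive_periodic (R : realType) (f : R -> R[i]) (T : R) :
  (forall x, f (x + T) = f x) -> forall x, cderive f (x + T) = cderive f x.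
Proof.
move=> fT x.
have periodic (F : R -> R) : (forall y, F (y + T) = F y) ->
    derive1 F (x + T) = derive1 F x.
  (* The difference quotients at [x + T] and at [x] coincide. *)
  by move=> FT; rewrite /derive1; under eq_fun do rewrite addrA !FT.
by rewrite /cderive !periodic // => y; rewrite fT.
Qed.

Lemma smooth_circle_cderiven (R : realType) n (f : R -> R[i]) :
  smooth_circle f -> smooth_circle (cderiven n f).
Proof.
move=> [fT sf]; split; last exact: (csmooth_cderiven n sf).
by elim: n => // n IHn; rewrite cderivenS; exact: cderive_periodic.
Qed.

Lemma smooth_circle_lin (R : realType) c (f g : R -> R[i]) :
  smooth_circle f -> smooth_circle g -> smooth_circle (fun x => c * f x + g x).
Proof.
move=> [fT sf] [gT sg]; split; last exact: (csmooth_lin c sf sg).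
by move=> x; rewrite fT gT.
Qed.

Lemma smooth_circle0 (R : realType) : smooth_circle (fun _ : R => 0).
Proof. by split=> //; exact: csmooth0. Qed.

Lemma smooth_circleZ (R : realType) c (f : R -> R[i]) :
  smooth_circle f -> smooth_circle (fun x => c * f x).
Proof.
move=> sf; rewrite (_ : (fun x => _) = fun x => c * f x + 0).
  exact: (smooth_circle_lin c sf (@smooth_circle0 R)).
by apply/funext => x; rewrite addr0.
Qed.

Lemma smooth_circle_Psi_monomial (R : realType) (h : R) mu a f m :
  smooth_circle f -> smooth_circle (Psi_monomial h mu a f m).
Proof.
move=> sf; have [am|[l ->]] := int_gt_or_sub a m.
  by rewrite (Psi_monomial_order_le _ _ _ am); exact: smooth_circle0.
by rewrite Psi_monomialE; apply: smooth_circleZ; exact: smooth_circle_cderiven.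
Qed.

Lemma smooth_circle_affine (R : realType) lambda nu (f : R -> R[i]) :
  smooth_circle f -> smooth_circle (fun y => lambda * cderive f y + nu * f y).
Proof.
move=> sf; apply: smooth_circle_lin; first exact: (smooth_circle_cderiven 1 sf).
exact: smooth_circleZ.
Qed.

Lemma pitilde_order_le (R : realType) (h : R) lambda mu nu f :
  csmooth f -> order_le 1 (pitilde h lambda mu nu f).
Proof.
move=> sf m lt1m; rewrite pitildeE //; apply/funext => x.
by rewrite !(Psi_monomial_order_le _ _ _ (_ : _ < m)) ?addr0 //; lia.
Qed.

Lemma circ_Psi_order1 (R : realType) (h : R) mu f u g v m x :
  csmooth f -> csmooth u -> csmooth g -> csmooth v ->
  circ h
    (fun n y => Psi_monomial h mu 1 f n y + Psi_monomial h mu 0 u n y)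
    (fun n y => Psi_monomial h mu 1 g n y + Psi_monomial h mu 0 v n y) m x =
  Psi_monomial h mu (1 + 1) (fun y => f y * g y) m x +
    h%:C * Psi_monomial h mu 1 (fun y => f y * cderive g y) m x +
  (Psi_monomial h mu 1 (fun y => f y * v y) m x +
    h%:C * Psi_monomial h mu 0 (fun y => f y * cderive v y) m x) +
  (Psi_monomial h mu 1 (fun y => u y * g y) m x +
    Psi_monomial h mu 0 (fun y => u y * v y) m x).
Proof.
move=> sf su sg sv.
(* Additivity of [circ] uses a common order bound, so order 0 is relaxed to order 1. *)
have le0 k : order_le 1 (Psi_monomial h mu 0 k).
  by move=> n lt1n; apply: Psi_monomial_order_le; lia.
have le1 k : order_le 1 (Psi_monomial h mu 1 k) by exact: Psi_monomial_order_le.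
have leg : order_le 1 (fun n y => Psi_monomial h mu 1 g n y + Psi_monomial h mu 0 v n y).
  by move=> n lt1n; apply/funext => y; rewrite le1 // le0 // addr0.
rewrite (circDl h m x (le1 _) (le0 _) leg).
have gD F (F1 : order_le 1 F) := circDr h m x F1 (le1 g) (le0 v)
  (fun n => csmooth_Psi_monomial h mu 1 n sg)
  (fun n => csmooth_Psi_monomial h mu 0 n sv).
rewrite (gD _ (le1 f)) (gD _ (le0 u)).
rewrite (circ_Psi_monomial1 h mu 1 m x sf sg).
rewrite (circ_Psi_monomial1 h mu 0 m x sf sv) addr0.
rewrite (circ_Psi_monomial0 h mu 1 m x su sg).
by rewrite (circ_Psi_monomial0 h mu 0 m x su sv).
Qed.

(** In the antisymmetrized product the terms without derivatives cancel by commutativity. The rest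
    has a factor [h], cancelled by the bracket's [1/h], and the order 0 part reduces to [f v' - g u'
    = lambda [f, g]' + nu [f, g]]. *)
Lemma lie_hom_pitilde (R : realType) (h : R) lambda mu nu : h != 0 ->
  lie_hom h (pitilde h lambda mu nu).
Proof.
move=> h0; have hC0 : h%:C != 0 :> R[i] by rewrite eq_complex /= negb_and h0.
split.
- move=> f sf; split; last by exists 1; exact: (pitilde_order_le _ _ _ _ sf.2).
  move=> k; rewrite (pitildeE _ _ _ _ sf.2).
  rewrite (_ : (fun x => _) = fun x => 1 * Psi_monomial h mu 1 f k x +
     Psi_monomial h mu 0 (fun y => lambda * cderive f y + nu * f y) k x).
    have su := smooth_circle_affine lambda nu sf.
    exact: (smooth_circle_lin 1 (smooth_circle_Psi_monomial h mu 1 k sf)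
      (smooth_circle_Psi_monomial h mu 0 k su)).
  by apply/funext => x; rewrite mul1r.
- move=> a f g sf sg.
  have [sfT sfS] := sf; have [sgT sgS] := sg.
  have [_ suS] := smooth_circle_affine lambda nu sf.
  have [_ svS] := smooth_circle_affine lambda nu sg.
  rewrite (pitildeE h lambda mu nu sfS) (pitildeE h lambda mu nu sgS).
  rewrite (pitildeE h lambda mu nu (csmooth_lin a sfS sgS)).
  apply/funext => k; apply/funext => x.
  rewrite (Psi_monomial_lin h mu 1 a k x sfS sgS).
  rewrite (_ : (fun y => lambda * _ + _) = fun y =>
    a * (lambda * cderive f y + nu * f y) + (lambda * cderive g y + nu * g y)).
    by rewrite (Psi_monomial_lin h mu 0 a k x suS svS); ring.
  apply/funext => y.
  have -> : cderive (fun z => a * f z + g z) y = a * cderive f y + cderive g y.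
    exact: (congr1 (fun F => F y) (cderiven_lin a 1 sfS sgS)).
  by move: (cderive f y) (cderive g y) (f y) (g y) => *; ring.
move=> f g [_ sf] [_ sg]; apply/funext => m; apply/funext => x.
have sf' := csmooth_cderive sf; have sg' := csmooth_cderive sg.
set u := fun y => lambda * cderive f y + nu * f y.
set v := fun y => lambda * cderive g y + nu * g y.
have su : csmooth u := csmooth_lin lambda sf' (csmoothZ nu sf).
have sv : csmooth v := csmooth_lin lambda sg' (csmoothZ nu sg).
(* Written in the shape [c * k + l] expected by the linearity lemmas. *)
have bracketE :
    vect_bracket f g = fun y => -1 * (g y * cderive f y) + f y * cderive g y.
  by apply/funext => y; rewrite /vect_bracket; ring.
have sb : csmooth (vect_bracket f g).
  by rewrite bracketE; exact: (csmooth_lin _ (csmoothM sg sf') (csmoothM sf sg')).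
rewrite /symbol_bracket (pitildeE h lambda mu nu sf) (pitildeE h lambda mu nu sg).
rewrite (pitildeE h lambda mu nu sb) -/u -/v.
rewrite (circ_Psi_order1 h mu m x sf su sg sv) (circ_Psi_order1 h mu m x sg sv sf su).
have swap (k l : R -> R[i]) : (fun y => k y * l y) = fun y => l y * k y.
  by apply/funext => y; rewrite mulrC.
rewrite (swap g f) (swap g u) (swap v f) (swap v u).
set P0 := Psi_monomial h mu 0; set P1 := Psi_monomial h mu 1.
rewrite (_ : _ - _ = h%:C * (
    (P1 (fun y => f y * cderive g y) m x - P1 (fun y => g y * cderive f y) m x) +
    (P0 (fun y => f y * cderive v y) m x - P0 (fun y => g y * cderive u y) m x)));
  last by ring.
rewrite mulKf //.
have PB a k l w : csmooth k -> csmooth l -> w = (fun y => -1 * l y + k y) ->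
    Psi_monomial h mu a w m x =
    Psi_monomial h mu a k m x - Psi_monomial h mu a l m x.
  by move=> sk sl ->; rewrite Psi_monomial_lin // mulN1r addrC.
congr (_ + _); first exact: (PB 1 _ _ _ (csmoothM sf sg') (csmoothM sg sf') bracketE).
have sv' := csmooth_cderive sv; have su' := csmooth_cderive su.
apply: (PB 0 _ _ _ (csmoothM sf sv') (csmoothM sg su')).
apply/funext => y.
have uE : cderive u y = lambda * cderive (cderive f) y + nu * cderive f y.
  exact: (cderive_affine lambda nu y sf).
have vE : cderive v y = lambda * cderive (cderive g) y + nu * cderive g y.
  exact: (cderive_affine lambda nu y sg).
(* The two products [f' g'] cancel. *)
have bE : cderive (vect_bracket f g) y =
    f y * cderive (cderive g) y - cderive (cderive f) y * g y.
  have [dgf gfE] := is_cderiveM (sg 0 y) (sf' 0 y).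
  have [dfg fgE] := is_cderiveM (sf 0 y) (sg' 0 y).
  rewrite bracketE; have [dgfN gfNE] := is_cderiveZ (-1) dgf.
  rewrite (etrans (is_cderiveD dgfN dfg).2 (f_equal2 +%R gfNE fgE)) gfE /=.
  move: (cderive (cderive f) y) (cderive (cderive g) y) (cderive f y) (cderive g y).
  by move: (f y) (g y) => *; ring.
rewrite bE uE vE /vect_bracket.
move: (cderive (cderive f) y) (cderive (cderive g) y) (cderive f y) (cderive g y).
by move: (f y) (g y) => *; ring.
Qed.

(** * The infinitesimal part of [pitilde] *)

Lemma diffop_widen (R : realType) (p : {poly R[i]}) (f : R -> R[i]) n x :
  (size p <= n)%N -> diffop p f x = \sum_(j < n) p`_j * cderiven j f x.
Proof.
move=> le_pn; rewrite /diffop (big_ord_widen n (fun j => p`_j * cderiven j f x)) //.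
rewrite big_mkcond; apply: eq_bigr => j _; case: ltnP => // le_pj.
by rewrite nth_default ?mul0r.
Qed.

Lemma diffop_binomial (R : realType) (a b : R[i]) k (f : R -> R[i]) x :
  diffop (a *: 'X^(k.+1) + b *: 'X^k) f x =
    a * cderiven k.+1 f x + b * cderiven k f x.
Proof.
(* Vanishing coefficients may lower the size of the polynomial, hence the fixed range [k.+2]. *)
rewrite (@diffop_widen R _ f k.+2 x); last first.
  rewrite (leq_trans (size_polyD _ _)) // geq_max.
  by rewrite !(leq_trans (size_scale_leq _ _)) // size_polyXn.
rewrite !big_ord_recr /= !coefD !coefZ !coefXn !eqxx big1 => [|i _].
  rewrite (ltn_eqF (ltnSn k)) (gtn_eqF (ltnSn k)) !mulr0 !mulr1 !add0r addr0.
  by rewrite addrC.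
rewrite coefD !coefZ !coefXn (ltn_eqF (ltn_ord i)).
by rewrite (ltn_eqF (ltnW (ltn_ord i) : (i < k.+1)%N)) !mulr0 addr0 mul0r.
Qed.

Lemma infinitesimal_part_pitilde (R : realType) (h : R) lambda mu nu : h != 0 ->
  infinitesimal_part h (pitilde h lambda mu nu) nu (mu + lambda)
    (mu * (mu - h%:C) / 2 + lambda * mu)
    (mu * (mu - h%:C) * (mu - 2 * h%:C) / 6 + lambda * (mu * (mu - h%:C) / 2)).
Proof.
move=> h0; split; first exact: lie_hom_pitilde.
pose P := hbinom h%:C mu.
(* Degree [-k] lies at depth [k + 1] below [f xi] and at depth [k] below [lambda f' + nu f]. *)
exists (fun k => (P k.+1 + P k * lambda) *: 'X^(k.+1) + (P k * nu) *: 'X^k).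
split; last first.
  rewrite !coefD !coefZ !coefXn /= /P /hbinom !big_ord_recr !big_ord0 /=.
  rewrite (_ : 3`! = 6)%N // (_ : 2`! = 2)%N // fact0 (_ : 1`! = 1)%N //.
  by split; field.
move=> f [_ sf]; have [saf] := (smooth_circle_affine, sf).
split; first exact: pitilde_order_le.
  rewrite pitildeE //; apply/funext => x.
  rewrite [X in _ + X](_ : _ = 0); last first.
    by rewrite (Psi_monomial_order_le _ _ _ (_ : 0 < 1)).
  rewrite -[X in Psi_monomial _ _ _ _ X _](subr0 1) (Psi_monomialE _ _ _ _ 0).
  by rewrite hbinom0 mul1r addr0.
move=> k; apply/funext => x; rewrite pitildeE // diffop_binomial.
rewrite [in X in X + _](_ : - k%:Z = 1 - k.+1%:Z); last by lia.
rewrite -[- k%:Z]add0r !Psi_monomialE.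
rewrite (cderiven_lin lambda k (csmooth_cderive sf) (csmoothZ nu sf)).
rewrite (cderivenZ nu k sf) -cderivenSr -/P.
by move: (cderiven k.+1 f x) (cderiven k f x) => *; ring.
Qed.

(** * Solving for the parameters *)

Theorem lemma8p1 (R : realType) (h : R) (h_gt0 : 0 < h) (h_le1 : h <= 1)
    (c0 c1 c2 c3 : R[i])
    (Hc : 6 * c1 ^+ 3 * c3 - 3 * c1 ^+ 2 * c2 ^+ 2 - 18 * c1 * c2 * c3
            + 8 * c2 ^+ 3 + 9 * c3 ^+ 2
          + h%:C * (3 * c1 ^+ 3 * c2 - 6 * c1 * c2 ^+ 2 - 9 * c1 ^+ 2 * c3
                    + 18 * c2 * c3)
          + h%:C ^+ 2 * (3 * c1 * c3 - 5 * c1 ^+ 2 * c2 + 8 * c2 ^+ 2)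
          + 2 * h%:C ^+ 3 * c1 * c2 = 0) :
  exists lambda mu nu : R[i],
    infinitesimal_part h (pitilde h lambda mu nu) c0 c1 c2 c3.
Proof.
have h0 : h != 0 by rewrite gt_eqF.
pose H := h%:C : R[i]; rewrite -/H in Hc.
(* Six times the equation for [c3], after substituting [lambda = c1 - mu]. *)
pose cubic (mu : R[i]) := 6 * c3 - mu * (mu - H) * (3 * c1 - 2 * mu - 2 * H).
suff [mu c2E c3E] : exists2 mu, 2 * c2 = mu * (2 * c1 - H - mu) & cubic mu = 0.
  exists (c1 - mu), mu, c0.
  have := infinitesimal_part_pitilde (c1 - mu) mu c0 h0; rewrite -/H.
  rewrite (_ : mu + (c1 - mu) = c1); last by ring.
  rewrite (_ : _ / 2 + _ = c2); last first.
    by rewrite -[c2](mulKf (_ : 2 != 0)) ?c2E ?pnatr_eq0 //; field.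
  rewrite (_ : _ / 6 + _ = c3) //.
  have -> : c3 = (cubic mu + mu * (mu - H) * (3 * c1 - 2 * mu - 2 * H)) / 6.
    by rewrite /cubic; field.
  by rewrite c3E; field.
(* A square root of the discriminant of [mu^2 - (2 c1 - H) mu + 2 c2]. *)
pose s := sqrtC ((2 * c1 - H) ^+ 2 - 8 * c2).
pose r := (2 * c1 - H + s) / 2.
(* The two roots are [r] and [2 c1 - H - r]; writing [c2] as half their product
   makes the resultant identity below a polynomial identity. *)
have c2E : c2 = r * (2 * c1 - H - r) / 2.
  rewrite (_ : _ * _ / 2 = ((2 * c1 - H) ^+ 2 - s ^+ 2) / 8); last by rewrite /r; field.
  by rewrite sqrtCK; field.
(* This product is 4 times the left side of [Hc]. *)
have : cubic r * cubic (2 * c1 - H - r) = 0.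
  by rewrite -[RHS](mulr0 4) -Hc c2E /cubic; field.
move/eqP; rewrite mulf_eq0 => /orP[] /eqP cubic0.
  by exists r => //; rewrite c2E; field.
by exists (2 * c1 - H - r) => //; rewrite c2E; field.
Qed.
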